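(* Let $X$ and $Y$ be topological vector spaces (over $\mathbb{R}$), let $\theta$ be the origin of $Y$, let $D$ be a nonempty convex subset of $X$, and let $K$ be a nonempty set. Let $F: D\times K \rightrightarrows Y$ and $G: D\times D\rightrightarrows Y$ be set-valued mappings satisfying: (i) for each $y\in K$, the set $\{x\in D: \theta\in F(x,y)\}$ is compactly closed; (ii) $G$ is a KKM-type mapping on $D$; (iii) for each $y\in K$ there exists $z\in D$ such that for all $x\in D$, $\theta\in G(z,x)$ implies $\theta\in F(x,y)$; (iv) there exist a nonempty compact subset $M$ of $D$ and a finite subset $L$ of $K$ such that for each $x\in D\setminus M$ there exists $y\in L$ with $\theta\notin F(x,y)$. Then there exists $\bar x\in M$ such that $\theta\in F(\bar x,y)$ for all $y\in K$.
   Context: A subset $A$ of a topological space $X$ is compactly closed if for every compact subset $M$ of $X$ the set $A\cap M$ is closed in $M$. A set-valued mapping $G: D\times D\rightrightarrows Y$ is called a KKM-type mapping on $D$ if for every finite subset $\{x_1,\dots,x_n\}\subset D$ and every $x\in \operatorname{co}\{x_1,\dots,x_n\}\cap D$ there exists $j\in\{1,\dots,n\}$ such that $\theta\in G(x_j,x)$. Here $\operatorname{co}$ denotes the convex hull. *)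

(* Defs.v *)
From HB Require Import structures.
From mathcomp Require Import all_boot all_order all_algebra.
From mathcomp Require Import all_classical all_reals all_analysis.
Set Implicit Arguments. Unset Strict Implicit. Unset Printing Implicit Defensive.
Import Order.TTheory GRing.Theory Num.Theory.
Local Open Scope classical_set_scope.
Local Open Scope ring_scope.

Definition conv_hull (R : realType) (E : lmodType R) (S : set E) : set E :=
  [set x | exists (n : nat) (w : 'I_n -> R) (p : 'I_n -> E),
     [/\ (forall i, 0 <= w i), \sum_(i < n) w i = 1, (forall i, S (p i))
       & x = \sum_(i < n) w i *: p i]].

Definition compactly_closed (X : topologicalType) (A : set X) : Prop :=
  forall M : set X, compact M -> @closed (subspace M) (A `&` M).

Definition KKM_type (R : realType) (X : lmodType R) (Y : lmodType R)
  (D : set X) (G : X -> X -> set Y) : Prop :=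
  forall (n : nat) (xs : 'I_n -> X), (forall i, D (xs i)) ->
  forall x, conv_hull (range xs) x -> D x -> exists j : 'I_n, G (xs j) x 0.

(* Main.v *)
Require Import Defs.
From HB Require Import structures.
From mathcomp Require Import all_boot.
From mathcomp Require Import zify.
Set Implicit Arguments.
Unset Strict Implicit.
Unset Printing Implicit Defensive.

(** For finitely many [y_i] in [K] pick [z_i] as in (iii) and pull the sets
    [{x | theta in F(x, y_i)}] back along [w |-> sum_i w_i z_i]; they form a
    closed KKM cover of the standard simplex, so they meet. Adding [L] to the
    [y_i] forces the common point into [M], and compactness of [M] concludes.

    The KKM theorem itself follows from a triangulation-free substitute for
    Sperner's lemma (Scarf; Petri and Voorneveld): given finitely many total
    orders on a finite set, call [S] dominant if no point exceeds the minimum of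
    [S] in every order at once; by a door-counting argument every colouring has
    a dominant set carrying all colours. If closed sets [C_i] had no common
    point, each point [v] of a fine grid could be coloured by an [i] such that
    a whole ball around [v] avoids [C_i]. A dominant rainbow set is clustered
    near a point [x] of the face spanned by its genuine colours, and that [x]
    cannot lie in any [C_i] of the face. *)

(** * Dominant sets and their one-point extensions *)

Section Scarf.
Variables (U I : finType) (o : I -> U -> nat).
Hypothesis o_inj : forall i, injective (o i).

Definition dominant (S : {set U}) :=
  [forall w, exists i, forall s in S, o i w <= o i s].

Lemma dominantP (S : {set U}) :
  reflect (forall w, exists i, {in S, forall s, o i w <= o i s}) (dominant S).
Proof.
apply: (iffP forallP) => H w.
  by have /existsP[i /forall_inP] := H w; exists i.
by have [i Hi] := H w; apply/existsP; exists i; apply/forall_inP.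
Qed.

Lemma dominantS (S T : {set U}) : T \subset S -> dominant S -> dominant T.
Proof.
move=> TS /dominantP domS; apply/dominantP => w; have [i wS] := domS w.
by exists i => t /(subsetP TS)/wS.
Qed.

Definition is_min (T : {set U}) (m : I -> U) :=
  forall i, m i \in T /\ {in T, forall t, o i (m i) <= o i t}.

Lemma min_exists (T : {set U}) : T != set0 -> exists m, is_min T m.
Proof.
case/set0Pn => t0 Tt0.
by exists (fun i => [arg min_(t < t0 in T) o i t]) => i; case: arg_minnP.
Qed.

Lemma o_leqNeq i u v : o i u <= o i v -> u != v -> o i u < o i v.
Proof. by rewrite ltn_neqAle (inj_eq (@o_inj i)) => -> ->. Qed.

(* Once [m] lists the minima of [T], extending [T] to a larger dominant set
   means choosing a [k]-maximal point of [above m k] for an index [k] at which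
   two minima collide. *)
Definition above (m : I -> U) k : {set U} :=
  [set w | [forall (l | l != k), o l (m l) < o l w]].

Lemma aboveP m k w :
  reflect (forall l, l != k -> o l (m l) < o l w) (w \in above m k).
Proof. by rewrite inE; apply: (iffP forall_inP). Qed.

Definition tops (W : {set U}) k :=
  [set u in W | [forall w in W, o k w <= o k u]].

Lemma topsP (W : {set U}) k u :
  reflect (u \in W /\ {in W, forall w, o k w <= o k u}) (u \in tops W k).
Proof.
rewrite inE; apply: (iffP andP) => -[uW H]; split => //; exact/forall_inP.
Qed.

Lemma card_tops (W : {set U}) k : #|tops W k| = (W != set0).
Proof.
have [->|/set0Pn[w0 Ww0]] /= := eqVneq W set0.
  by apply/eqP; rewrite cards_eq0 -subset0; apply/subsetP => u /topsP[].
have [u uW umax] := @arg_maxnP _ w0 (mem W) (o k) Ww0.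
rewrite -(cards1 u); congr #|pred_of_set _|; apply/setP => v; rewrite in_set1.
apply/topsP/eqP => [[vW vmax]|->]; last by split.
by apply: (@o_inj k); apply/eqP; rewrite eqn_leq vmax // andbT; exact: umax.
Qed.

Lemma min_collision (T : {set U}) m : #|T|.+1 = #|I| -> is_min T m ->
  exists i j, i != j /\ m i = m j.
Proof.
move=> cT mT.
have /injectivePn[i [j ij mij]] : ~~ injectiveb m; last by exists i, j.
apply/negP => /injectiveP minj.
have : #|[set m i | i in I]| <= #|T|.
  by apply/subset_leq_card/subsetP => _ /imsetP[i _ ->]; have [] := mT i.
by rewrite card_imset // -cT ltnn.
Qed.

(** An extension has as many points as there are orders, so each of its points is the minimum in
    exactly one order. Every order but that of [u] keeps its minimum in [T], so [u] must take over
    one of the two colliding orders [i] and [j]. *)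
Lemma extensionsE (T : {set U}) m i j :
  #|T|.+1 = #|I| -> is_min T m -> dominant T -> i != j -> m i = m j ->
  [set u | u \notin T & dominant (u |: T)] =
  tops (above m i) i :|: tops (above m j) j.
Proof.
move=> cT mT /dominantP domT ij mij.
(* By dominance [u] lies below [T] in some order, and [above m k] rules out every order but [k]. *)
have key k u : u \in above m k -> {in T, forall t, o k u <= o k t}.
  move=> /aboveP uW; have [l ul] := domT u.
  have [<-//|/uW] := eqVneq l k.
  by rewrite ltnNge ul //; have [] := mT l.
have topsdom k u : u \in tops (above m k) k -> dominant (u |: T).
  case/topsP => uW umax; apply/dominantP => w.
  have [wW|] := boolP (w \in above m k).
    exists k => s /setU1P[->|sT]; first exact: umax.
    exact: leq_trans (umax _ wW) (key _ _ uW _ sT).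
  rewrite inE negb_forall_in => /exists_inP[l lk]; rewrite -leqNgt => wl.
  exists l => s /setU1P[->|sT]; last by apply: leq_trans wl _; apply (mT l).2.
  by apply: leq_trans wl _; apply/ltnW/(aboveP _ _ _ uW).
(* Inside [T], [u] would be the [k]-minimum [m k = m k'], yet it strictly exceeds [m k'] in order
   [k']. *)
have notT k k' u : k != k' -> m k = m k' -> u \in above m k -> u \notin T.
  move=> kk' mkk' uW; apply/negP => uT.
  have /eqP uk : u == m k.
    rewrite -(inj_eq (@o_inj k)) eqn_leq (key _ _ uW) ?(mT k).1 //.
    exact: (mT k).2.
  by have /aboveP/(_ k') := uW; rewrite eq_sym kk' -mkk' uk ltnn => /(_ isT).
apply/setP => u; rewrite inE in_setU; apply/andP/orP => [[uT]|]; last first.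
  case=> uk; split; try exact: topsdom uk.
    by move/topsP: uk => [uW _]; exact: notT ij mij uW.
  by move/topsP: uk => [uW _]; apply: (notT j i) uW; rewrite // eq_sym.
move=> /dominantP domu.
(* [l s] is an order in which [s] is the minimum of [u |: T]; by cardinality [l] maps [u |: T]
   bijectively onto [I]. *)
pose l s := xchoose (existsP (forallP (introT (dominantP _) domu) s)).
have lP s : {in u |: T, forall t, o (l s) s <= o (l s) t}.
  exact/forall_inP/(xchooseP (existsP (forallP (introT (dominantP _) domu) s))).
have linj : {in u |: T &, injective l}.
  move=> s t sT tT lst; apply: (@o_inj (l s)); apply/eqP; rewrite eqn_leq.
  by rewrite lP //= lst lP.
have lsurj i' : exists2 s, s \in u |: T & i' = l s.
  suff /setP/(_ i') : l @: (u |: T) = setT by rewrite inE => /imsetP.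
  by apply/eqP; rewrite eqEcard subsetT cardsT card_in_imset //
    cardsU1 uT add1n cT leqnn.
have uuT : u \in u |: T by rewrite setU11.
have lm i' : i' != l u -> exists2 t, t \in T & i' = l t /\ t = m i'.
  move=> i'u; have [s /setU1P[-> il|sT il]] := lsurj i'.
    by rewrite il eqxx in i'u.
  exists s => //; split=> //; apply: (@o_inj i'); apply/eqP.
  rewrite eqn_leq (mT i').2 // andbT {1 2}il lP //.
  by rewrite setU1r // (mT i').1.
have uW : u \in above m (l u).
  apply/aboveP => l' /lm[t tT [l't tm]]; rewrite -tm; apply: o_leqNeq.
    by rewrite l't lP.
  by apply: contraNneq uT => <-.
have umax : {in above m (l u), forall w, o (l u) w <= o (l u) u}.
  move=> w /aboveP wW; have [l' wl'] := domu w.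
  have [<-|/wW] := eqVneq l' (l u); first exact: wl'.
  by rewrite ltnNge wl' // setU1r // (mT l').1.
have utop : u \in tops (above m (l u)) (l u) by apply/topsP.
have [lui|/lm[t tT [it tm]]] := eqVneq i (l u); first by left; rewrite lui.
have [luj|/lm[t' tT' [jt' tm']]] := eqVneq j (l u); first by right; rewrite luj.
by move: ij; rewrite it jt' tm mij -tm' eqxx.
Qed.

(** A common point would exceed the minimum of [T] in every order. *)
Lemma disjoint_above (T : {set U}) m i j :
  is_min T m -> dominant T -> i != j ->
  [disjoint tops (above m i) i & tops (above m j) j].
Proof.
move=> mT /dominantP domT ij; rewrite -setI_eq0 -subset0; apply/subsetP => u.
case/setIP => /topsP[/aboveP ui _] /topsP[/aboveP uj _].
have [l ul] := domT u.
have : o l (m l) < o l u.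
  by have [li|/ui//] := eqVneq l i; apply: uj; rewrite li.
by rewrite ltnNge ul // (mT l).1.
Qed.

Lemma card_extensions (T : {set U}) m i j :
  #|T|.+1 = #|I| -> is_min T m -> dominant T -> i != j -> m i = m j ->
  #|[set u | u \notin T & dominant (u |: T)]| =
  (above m i != set0) + (above m j != set0).
Proof.
move=> cT mT domT ij mij; rewrite (extensionsE cT mT domT ij mij).
by rewrite cardsU (disjoint_setI0 (disjoint_above mT domT ij)) cards0 subn0
  !card_tops.
Qed.

(** * Door counting, where a door carries every colour but [i0] *)

Variables (c : U -> I) (i0 : I).

(** A rainbow [S] has one door, left by removing its point of colour [i0]. Otherwise, if there is a
    door at all, exactly two points share a colour, and removing either leaves a door. *)
Lemma odd_card_facets (S : {set U}) : #|S| = #|I| ->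
  odd #|[set u in S | c @: (S :\ u) == [set~ i0]]| = (c @: S == setT).
Proof.
move=> cS.
have inj1 u : u \in S -> c @: (S :\ u) = [set~ i0] ->
    {in S :\ u &, injective c}.
  move=> uS cu; apply/imset_injP; rewrite cu cardsC1 -cS.
  by rewrite (cardsD1 u S) uS.
have [cT|cNT] := eqVneq (c @: S) setT.
  have cinj : {in S &, injective c} by apply/imset_injP; rewrite cT cardsT cS.
  have /imsetP[u0 u0S iu0] : i0 \in c @: S by rewrite cT inE.
  rewrite (_ : [set u in S | _] = [set u0]) ?cards1 //.
  apply/setP => u; rewrite !inE; apply/andP/eqP => [[uS /eqP cu]|->].
    apply/eqP/negPn/negP => uu0; have : c u0 \in c @: (S :\ u).
      by rewrite imset_f // !inE eq_sym uu0.
    by rewrite cu !inE -iu0 eqxx.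
  split=> //; rewrite eqEcard cardsC1 -cS card_in_imset; last first.
    by move=> v w /setD1P[_ vS] /setD1P[_ wS]; exact: cinj.
  rewrite (cardsD1 u0 S) u0S add1n leqnn andbT.
  apply/subsetP => _ /imsetP[v /setD1P[vu0 vS] ->]; rewrite !inE iu0.
  by apply: contraNneq vu0 => /cinj ->.
have [->|/set0Pn[u]] := eqVneq [set u in S | c @: (S :\ u) == [set~ i0]] set0.
  by rewrite cards0.
rewrite inE => /andP[uS /eqP cu].
have cS_sub : c @: S \subset [set~ i0].
  apply/subsetP => _ /imsetP[v vS ->].
  have [->|vu] := eqVneq v u; last by rewrite -cu imset_f // !inE vu.
  apply: contraNT cNT; rewrite !inE negbK => /eqP cui0.
  apply/eqP/setP => i; rewrite inE; have [->|ii0] := eqVneq i i0.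
    by rewrite -cui0 imset_f.
  have : i \in [set~ i0] by rewrite !inE.
  by rewrite -cu => /imsetP[w /setD1P[_ wS] ->]; rewrite imset_f.
have : c u \in c @: (S :\ u) by rewrite cu (subsetP cS_sub) // imset_f.
case/imsetP => u' /setD1P[u'u u'S] cuu'.
rewrite (_ : [set u in S | _] = [set u; u']) ?cards2 1?eq_sym ?u'u //.
apply/setP => w; rewrite !inE; apply/andP/orP => [[wS /eqP cw]|].
  have [wu|wu] := eqVneq w u; first by left.
  have [wu'|wu'] := eqVneq w u'; first by right.
  move/eqP: u'u; case; apply: (inj1 w) => //; rewrite !inE.
    by rewrite eq_sym wu'.
  by rewrite eq_sym wu.
case=> /eqP ->; split=> //; first by rewrite cu.
rewrite eqEsubset; apply/andP; split.
  by apply: subset_trans cS_sub; apply/imsetS/subD1set.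
rewrite -{1}cu; apply/subsetP => _ /imsetP[v /setD1P[vu vS] ->].
have [->|vu'] := eqVneq v u'; last by rewrite imset_f // !inE vu'.
by rewrite -cuu' imset_f // !inE eq_sym u'u.
Qed.

(** Both sides count the pairs of a door [T] and a point [u] outside it with [u |: T] dominant,
    grouped by [S = u |: T] on the left and by [T] on the right. *)
Lemma double_counting :
  \sum_(S | dominant S && (#|S| == #|I|))
     #|[set u in S | c @: (S :\ u) == [set~ i0]]| =
  \sum_(T : {set U} | (#|T|.+1 == #|I|) && (c @: T == [set~ i0]))
     #|[set u | u \notin T & dominant (u |: T)]|.
Proof.
under eq_bigr do rewrite -sum1dep_card big_mkcond.
under [RHS]eq_bigr do rewrite -sum1dep_card big_mkcond.
rewrite exchange_big [RHS]exchange_big /=; apply: eq_bigr => u _.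
rewrite -!big_mkcondr (reindex_onto (fun T => u |: T) (fun S => S :\ u)) /=.
  apply: eq_bigl => T; have [uT|uT] := boolP (u \in T).
    rewrite (_ : _ == T = false) ?andbF //.
    by apply: contraTF uT => /eqP <-; rewrite setD11.
  by rewrite setU1K // eqxx setU11 cardsU1 uT add1n andbT /=
    -!andbA andbC -!andbA.
by move=> S /andP[_ /andP[uS _]]; rewrite setD1K.
Qed.

(* The dummy points [d i] play the role of the boundary of the simplex: they
   make every facet but [dummy_facet] extend in exactly two ways. *)
Variable d : I -> U.
Hypothesis dummy_bot : forall i u, o i (d i) <= o i u.
Hypothesis dummy_top : forall i k u,
  i != k -> u \notin codom d -> o i u < o i (d k).
Hypothesis c_dummy : forall i, c (d i) = i.
Variable v0 : U.
Hypothesis v0P : v0 \notin codom d.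

(** The genuine point [t] bounds all minima from above, and [d k] beats it in every order but
    [k]. *)
Lemma above_neq0 T m k t : is_min T m -> t \in T -> t \notin codom d ->
  above m k != set0.
Proof.
move=> mT tT td; apply/set0Pn; exists (d k); apply/aboveP => l lk.
by apply: leq_ltn_trans ((mT l).2 _ tT) _; exact: dummy_top.
Qed.

Let dummy_facet := d @: [set~ i0].

Lemma dummy_inj : injective d. Proof. exact: can_inj c_dummy. Qed.

Lemma card_dummy_facet : #|dummy_facet|.+1 = #|I|.
Proof.
rewrite (card_imset _ dummy_inj) cardsC1 prednK //.
by apply/card_gt0P; exists i0.
Qed.

Lemma imset_dummy_facet : c @: dummy_facet = [set~ i0].
Proof.
by rewrite -imset_comp -[RHS]imset_id; apply: eq_imset => i; exact: c_dummy.
Qed.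

Lemma dummy_facet_unique (T : {set U}) : c @: T = [set~ i0] -> #|T|.+1 = #|I| ->
  {subset T <= codom d} -> T = dummy_facet.
Proof.
move=> cT kT Td; apply/eqP.
rewrite eqEcard -ltnS card_dummy_facet -kT leqnn andbT.
apply/subsetP => t tT; have /codomP[i ti] := Td _ tT.
rewrite ti imset_f // -cT; apply/imsetP; exists t => //.
by rewrite ti c_dummy.
Qed.

Lemma dominant_dummy_facet : dominant dummy_facet.
Proof.
apply/dominantP => w; have [/codomP[l wl]|wd] := boolP (w \in codom d).
  by exists l => t _; rewrite wl dummy_bot.
exists i0 => t /imsetP[j]; rewrite !inE => ji0 ->; apply/ltnW/dummy_top => //.
by rewrite eq_sym.
Qed.

(** The orders [i0] and [j] share the minimum [d j]. On the [i0] side [v0] is available. On the [j]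
    side nothing is: genuine points stay below [d j] in order [i0], and no dummy strictly exceeds
    all the required minima. So there is exactly one extension. *)
Lemma odd_extensions_dummy_facet : 1 < #|I| ->
  odd #|[set u | u \notin dummy_facet & dominant (u |: dummy_facet)]|.
Proof.
move=> I1.
have : dummy_facet != set0 by rewrite -card_gt0 -ltnS card_dummy_facet.
case/min_exists => m mT.
have md l : l != i0 -> m l = d l.
  move=> li0; apply: (@o_inj l); apply/eqP; rewrite eqn_leq dummy_bot andbT.
  by apply: (mT l).2; rewrite imset_f // !inE.
have /imsetP[j] := (mT i0).1; rewrite !inE => ji0 mi0.
have mij : m i0 = m j by rewrite mi0 md.
have i0j : i0 != j by rewrite eq_sym.
rewrite (card_extensions card_dummy_facet mT dominant_dummy_facet i0j mij).
have -> : above m i0 != set0.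
  apply/set0Pn; exists v0; apply/aboveP => l li0; rewrite md //.
  apply: o_leqNeq; first exact: dummy_bot.
  by apply: contraNneq v0P => <-; rewrite codom_f.
rewrite (_ : above m j = set0) ?eqxx //.
apply/eqP; rewrite -subset0; apply/subsetP => w /aboveP wW.
have := wW _ i0j; rewrite mi0 => dw.
have [/codomP[l wl]|wd] := boolP (w \in codom d); last first.
  by have := dummy_top i0j wd; rewrite ltnNge (ltnW dw).
have [li0|li0] := eqVneq l i0.
  by move: dw; rewrite wl li0 ltnNge dummy_bot.
have [lj|lj] := eqVneq l j; first by move: dw; rewrite wl lj ltnn.
by have := wW _ lj; rewrite md // wl ltnn.
Qed.

(** Such a door contains a genuine point, so both colliding orders contribute an extension if [T] is
    dominant; if it is not, there are no extensions. *)
Lemma even_extensions (T : {set U}) : 1 < #|I| ->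
  #|T|.+1 = #|I| -> c @: T = [set~ i0] -> T != dummy_facet ->
  ~~ odd #|[set u | u \notin T & dominant (u |: T)]|.
Proof.
move=> I1 kT cT TNd.
have [domT|domT] := boolP (dominant T); last first.
  rewrite (_ : [set u | _] = set0) ?cards0 //; apply/setP => u; rewrite !inE.
  by apply: contraNF domT => /andP[_]; apply/dominantS/subsetUr.
have : T != set0 by rewrite -card_gt0 -ltnS kT.
case/min_exists => m mT; have [i [j [ij mij]]] := min_collision kT mT.
rewrite (card_extensions kT mT domT ij mij).
have /subsetPn[t tT td] : ~~ (T \subset codom d).
  by apply: contraNN TNd => /subsetP Td; rewrite (dummy_facet_unique cT kT Td).
by rewrite !(above_neq0 _ mT tT td).
Qed.

(** The dummy facet makes the total in [double_counting] odd, whereas without a dominant rainbow set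
    every [S] would contribute an even number. *)
Theorem dominant_rainbow : exists S, dominant S /\ c @: S = setT /\ #|S| = #|I|.
Proof.
(* With a single index [dummy_facet] is empty and has no minima; the maximum of order [i0] alone is
   then a rainbow set. *)
have [I1|I1] := ltnP 1 #|I|; last first.
  have I1' (i j : I) : i = j by have /fintype_le1P/(_ j) := I1; apply.
  have [u _ umax] := @arg_maxnP _ v0 predT (o i0) isT.
  exists [set u]; split; last split.
  - by apply/dominantP => w; exists i0 => s /set1P ->; exact: umax.
  - by apply/setP => i; rewrite imset_set1 !inE; apply/eqP.
  - rewrite cards1; apply/eqP; rewrite eqn_leq I1 andbT.
    by apply/card_gt0P; exists i0.
have [/existsP[S /and3P[domS /eqP cS /eqP kS]]|/existsPn noS] :=
  boolP [exists S, [&& dominant S, c @: S == setT & #|S| == #|I|]].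
  by exists S.
have := double_counting; rewrite [RHS](bigD1 dummy_facet) /=; last first.
  by rewrite card_dummy_facet imset_dummy_facet !eqxx.
move=> /(congr1 odd); rewrite oddD odd_extensions_dummy_facet // => /esym.
have even_sum (J : finType) (P : pred J) (F : J -> nat) :
    (forall x, P x -> ~~ odd (F x)) -> odd (\sum_(x | P x) F x) = false.
  move=> PF; apply: (big_ind (fun n => odd n = false)) => //
    [m n om on|x /PF /negbTE //].
  by rewrite oddD om on.
rewrite even_sum => [|T /andP[/andP[/eqP kT /eqP cT] TNd]]; last first.
  exact: even_extensions.
rewrite even_sum // => S /andP[domS kS].
rewrite odd_card_facets; last exact/eqP.
by have := noS S; rewrite domS kS andbT.
Qed.

End Scarf.

(** * The integer grid on the simplex and its rainbow clusters *)

Lemma lex_lt (K a b r : nat) : a < b -> r < K -> a * K + r < b * K.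
Proof.
move=> ab rK; apply: leq_trans (leq_mul ab (leqnn K)).
by rewrite mulSn addnC ltn_add2r.
Qed.

Section Grid.
Variables (n N : nat).

(** [v] stands for the point [v / N] of the standard simplex, kept integral so that the counting is
    exact. *)
Definition grid := {v : {ffun 'I_n.+1 -> 'I_N.+1} | \sum_i v i == N}.

(* Ties between equal [i]-th coordinates are broken by [enum_rank]; [inr k] is
   the [k]-th dummy, bottom in order [k] and above the whole grid in the
   others. *)
Definition grank (i : 'I_n.+1) (u : grid + 'I_n.+1) : nat :=
  match u with
  | inl v => (val v i).+1 * #|{: grid}|.+1 + enum_rank v
  | inr k => if k == i then 0 else N.+2 * #|{: grid}|.+1 + k
  end.

Lemma enum_rank_lt (v : grid) : enum_rank v < #|{: grid}|.+1.
Proof. by rewrite ltnW // ltnS ltn_ord. Qed.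

Lemma grank_lt (v : grid) i : grank i (inl v) < N.+2 * #|{: grid}|.+1.
Proof. by apply: lex_lt; [rewrite ltnS ltn_ord | exact: enum_rank_lt]. Qed.

Lemma grank_inj i : injective (grank i).
Proof.
move=> [v|k] [w|l].
- move/(congr1 (modn^~ #|{: grid}|.+1)).
  rewrite /= !modnMDl !modn_small ?enum_rank_lt //.
  by move/val_inj/enum_rank_inj ->.
- have /= := grank_lt v i; case: ifP => _ + vl; rewrite vl.
    by move: vl; rewrite mulSn.
  by rewrite ltnNge leq_addr.
- have /= := grank_lt w i; case: ifP => _ + vl; rewrite -vl.
    by move: vl; rewrite mulSn.
  by rewrite ltnNge leq_addr.
- rewrite /=; have [->|ki] := eqVneq k i; have [->|li] := eqVneq l i => //.
  by move/addnI/val_inj ->.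
Qed.

Lemma grid_above (A : {set 'I_n.+1}) (b : 'I_n.+1 -> nat) :
  \sum_(i in A) b i <= N ->
  exists v : grid, forall i, i \in A -> b i <= val v i.
Proof.
move=> bN.
(* The mass left over from [b] goes to coordinate [ord0]. *)
pose w i := (if i \in A then b i else 0) +
  (if i == ord0 then N - \sum_(i in A) b i else 0).
have wN : \sum_i w i = N.
  by rewrite big_split /= -!big_mkcond /= big_pred1_eq subnKC.
have wi i : w i < N.+1 by rewrite ltnS -wN (bigD1 i) //= leq_addr.
have vN : \sum_i [ffun i => Ordinal (wi i)] i == N.
  by apply/eqP; rewrite -[RHS]wN; apply: eq_bigr => i _; rewrite ffunE.
exists (exist (fun v : {ffun 'I_n.+1 -> 'I_N.+1} => \sum_i v i == N) _ vN).
move=> i iA.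
by rewrite /= ffunE /= /w iA leq_addr.
Qed.

(** [A] collects the colours whose dummy is missing from a dominant rainbow set. If the last bound
    failed, some grid point would strictly exceed every minimum [a i] on [A], and every remaining
    dummy in its own order, against dominance. *)
Lemma grid_rainbow (c : grid -> 'I_n.+1) :
  exists (A : {set 'I_n.+1}) (s : 'I_n.+1 -> grid) (a : 'I_n.+1 -> nat),
  [/\ {in A, forall i, c (s i) = i},
      {in A &, forall i j, a i <= val (s j) i} &
      N < \sum_(i in A) (a i).+1].
Proof.
pose c' (u : grid + 'I_n.+1) := match u with inl v => c v | inr k => k end.
have [v0 _] := @grid_above set0 (fun=> 0) ltac:(by rewrite big_set0).
have NotCodom (v : grid) : inl v \notin codom (@inr grid 'I_n.+1).
  by apply/codomP => -[].
have [] := @dominant_rainbow _ _ _ grank_inj c' ord0 inr _ _ _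
  (inl v0) (NotCodom v0).
- by move=> i u /=; rewrite eqxx.
- move=> i k [v|l] ik; last by rewrite codom_f.
  move=> _; apply: leq_trans (grank_lt v i) _.
  by rewrite /= eq_sym (negbTE ik) leq_addr.
- by [].
move=> S [/dominantP domS [cS _]].
pose A := [set i | inr i \notin S].
have sP i : exists v : grid, i \in A -> inl v \in S /\ c v = i.
  have [iA|_] := boolP (i \in A); last by exists v0.
  have : i \in c' @: S by rewrite cS inE.
  case/imsetP => -[v|k] uS /= iu; first by exists v.
  by move: iA; rewrite inE iu uS.
have [s sS] := fin_all_exists sP.
(* Only the values on [A] matter; there [i] itself seeds the search for the minimum. *)
pose a i : nat := val (s [arg min_(j < i in A) val (s j) i]) i.
have aP i : i \in A -> exists2 j, j \in A & a i = val (s j) i.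
  by move=> iA; rewrite /a; case: arg_minnP => // j jA _; exists j.
exists A, s, a; split.
- by move=> i /sS[].
- by move=> i j iA jA; rewrite /a; case: arg_minnP => // k kA; apply.
- rewrite ltnNge; apply/negP => /grid_above[w wP].
  have [i wi] := domS (inl w).
  have [iA|] := boolP (i \in A); last first.
    by rewrite inE negbK => /wi /=; rewrite eqxx.
  have [j jA aj] := aP _ iA.
  have := wi _ (sS _ jA).1; rewrite leqNgt => /negP; apply.
  (* A strict gap in the coordinate outweighs any tie-breaking rank. *)
  apply: (leq_trans (lex_lt (leqnn _) (enum_rank_lt _))).
  apply: leq_trans (leq_addr _ _); rewrite leq_mul2r ltnS -aj wP //.
Qed.

(** Take [a] on [A], zero elsewhere, and add the missing mass [N - b] at one index of [A]. The
    points [s i] with [i] in [A] also lie above [a] on [A] and have total [N], so no coordinate can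
    differ by [n.+2]. *)
Lemma grid_rainbow_near (c : grid -> 'I_n.+1) :
  exists w : 'I_n.+1 -> nat, \sum_i w i = N /\
    forall i, 0 < w i -> exists2 v : grid, c v = i &
      forall l, val v l < w l + n.+2 /\ w l < val v l + n.+2.
Proof.
have [A [s [a [cs as_ Na]]]] := grid_rainbow c.
have [j0 j0A] : exists j0, j0 \in A.
  by apply/set0Pn; apply: contraTneq Na => ->; rewrite big_set0.
pose b := \sum_(i in A) a i.
have sN j : \sum_i val (s j) i = N := eqP (valP (s j)).
have bN : b <= N.
  rewrite -(sN j0) [leqRHS](bigID (mem A)) /=; apply: leq_trans (leq_addr _ _).
  by apply: leq_sum => i iA; exact: as_.
have bn : N - b < n.+2.
  rewrite ltn_subLR //; apply: leq_trans Na _.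
  under eq_bigr do rewrite -addn1.
  rewrite big_split /= sum1_card leq_add2l (leq_trans (max_card _)) //.
  by rewrite card_ord.
pose w i := if i \in A then a i + (if i == j0 then N - b else 0) else 0.
exists w; split.
  rewrite -big_mkcond big_split /= -/b (bigD1 j0) //= eqxx.
  by rewrite [X in _ + (_ + X)]big1 ?addn0 ?subnKC // => i /andP[_ /negbTE ->].
move=> i wi.
have iA : i \in A by apply: contraTT wi => /negbTE iA; rewrite /w iA.
exists (s i); first exact: cs.
move=> l.
(* The coordinates in [A] other than [l] already carry their minima, which caps the mass left for
   [l]. *)
have sbN : val (s i) l + b <= N + (if l \in A then a l else 0).
  rewrite -[X in _ <= X + _](sN i) (bigD1 l) //= -addnA leq_add2l.
  case: ifPn => lA.
    rewrite /b (bigD1 l) //= addnC leq_add2r [leqRHS](bigID (mem A)) /=.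
    apply: leq_trans (leq_addr _ _).
    rewrite (eq_bigl (fun j => (j != l) && (j \in A))).
      by apply: leq_sum => j /andP[_ jA]; exact: as_.
    by move=> j; rewrite andbC.
  rewrite addn0 [leqRHS](bigID (mem A)) /=; apply: leq_trans (leq_addr _ _).
  rewrite /b [leqRHS](eq_bigl (mem A)).
    by apply: leq_sum => j jA; exact: as_.
  by move=> j /=; case: eqVneq => // ->; rewrite (negbTE lA).
move: sbN bN bn; rewrite /w; case: ifPn => lA; last by lia.
by have := as_ l i lA iA; case: ifP => _; lia.
Qed.

End Grid.

(* The KKM theorem on the standard simplex *)
From mathcomp Require Import all_boot all_order all_algebra.
From mathcomp Require Import all_classical all_reals all_analysis.
Import Order.TTheory GRing.Theory Num.Theory.
Import numFieldNormedType.Exports.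
Local Open Scope classical_set_scope.
Local Open Scope ring_scope.

Definition simplex (R : realType) (n : nat) : set 'rV[R]_n :=
  [set x | (forall i, 0 <= x 0 i) /\ \sum_i x 0 i = 1].

Lemma simplex_le1 (R : realType) (n : nat) (x : 'rV[R]_n) i :
  simplex x -> x 0 i <= 1.
Proof.
move=> [x0 x1]; rewrite -x1 (bigD1 i) //= lerDl.
by apply: sumr_ge0 => j _; exact: x0.
Qed.

Lemma compact_simplex (R : realType) (n : nat) : compact (@simplex R n).
Proof.
have cube : compact [set x : 'rV[R]_n | forall i, `[0, 1]%classic (x ord0 i)].
  apply: (@rV_compact R n (fun=> `[0, 1]%classic)) => _.
  exact: segment_compact.
apply: subclosed_compact cube _; last first.
  by move=> x sx i /=; rewrite in_itv /= sx.1 simplex_le1.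
rewrite (_ : @simplex R n =
  \bigcap_i ((fun x : 'rV[R]_n => x 0 i) @^-1` [set r | 0 <= r])
   `&` ((fun x : 'rV[R]_n => \sum_i x 0 i) @^-1` [set 1])); last first.
  by apply/seteqP; split => x [x0 x1]; split => // i; [move=> _|]; exact: x0.
apply: closedI.
  apply: closed_bigI => i _.
  apply: preimage_closed => [x _|]; last exact: closed_ge.
  exact: coord_continuous.
apply: preimage_closed => [x _|]; last exact: closed_eq.
apply: continuous_big => [|i _]; first exact: add_continuous.
exact: coord_continuous.
Qed.

(** Compactness yields one radius for all points, like a Lebesgue number. The form [n.+2 / N] is the
    spread from [grid_rainbow_near] rescaled by [N]. *)
Lemma avoid_nbhs (R : realType) n (C : 'I_n.+1 -> set 'rV[R]_n.+1) :
  (forall i, closed (C i)) ->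
  ~ (exists2 x, simplex x & forall i, C i x) ->
  exists2 N : nat, (0 < N)%N & forall x, simplex x ->
    exists i, forall y, ball x (n.+2%:R / N%:R) y -> ~ C i y.
Proof.
move=> clC noC.
have : \forall N \near \oo, @simplex R n.+1 `<=`
    [set x | exists i, forall y, ball x (n.+2%:R / N%:R) y -> ~ C i y].
  have /compact_near_coveringP cov := @compact_simplex R n.+1.
  apply: (cov _ \oo (fun N x => exists i, forall y,
            ball x (n.+2%:R / N%:R) y -> ~ C i y)) => x sx.
  have /existsNP[i Cix] : ~ forall i, C i x by move=> Cx; apply: noC; exists x.
  have : nbhs x (~` C i).
    by apply: open_nbhs_nbhs; split => //; exact: closed_openC.
  move=> /nbhs_ballP[e /= e0 eC].
  near=> x' N => /=; exists i => y x'y; apply: eC.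
  (* Half of [e] covers the move from [x] to [x'], the other half the radius once [N] is large. *)
  rewrite [e]splitr; apply: (@ball_triangle _ _ x').
    by near: x'; apply: nbhsx_ballx; rewrite divr_gt0.
  apply: le_ball x'y.
  have N0 : (0 < N)%N by near: N; exact: nbhs_infty_gt.
  rewrite ler_pdivrMr ?ltr0n // -ler_pdivrMl ?divr_gt0 //.
  by near: N; exact: nbhs_infty_ger.
case=> N0 _ HN; exists N0.+1 => // x sx.
exact: (HN N0.+1 (leqnSn _) x sx).
Unshelve. all: by end_near. Qed.

(** Asking for [0 < x 0 i] encodes the face condition: [i] must be a vertex of the smallest face
    containing [x]. *)
Theorem KKM (R : realType) n (C : 'I_n.+1 -> set 'rV[R]_n.+1) :
  (forall i, closed (C i)) ->
  (forall x, simplex x -> exists2 i, 0 < x 0 i & C i x) ->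
  exists2 x, simplex x & forall i, C i x.
Proof.
move=> clC cov; apply: contrapT => /(avoid_nbhs clC)[N N0 HN].
have NR0 : 0 < N%:R :> R by rewrite ltr0n.
pose pt (v : grid n N) : 'rV[R]_n.+1 := \row_i ((val v i : nat)%:R / N%:R).
have spt v : simplex (pt v).
  split=> [i|]; first by rewrite mxE divr_ge0.
  under eq_bigr do rewrite mxE.
  by rewrite -mulr_suml -natr_sum (eqP (valP v)) divff // gt_eqF.
have /choice[c cP] : forall v, exists i, forall y,
    ball (pt v) (n.+2%:R / N%:R) y -> ~ C i y by move=> v; exact: HN.
have [w [wN wP]] := grid_rainbow_near c.
(* Every index at which [x] is positive is the colour of a grid point near [x]. *)
pose x : 'rV[R]_n.+1 := \row_i ((w i)%:R / N%:R).
have sx : simplex x.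
  split=> [i|]; first by rewrite mxE divr_ge0.
  under eq_bigr do rewrite mxE.
  by rewrite -mulr_suml -natr_sum wN divff // gt_eqF.
have [i xi Cix] := cov x sx.
have wi : (0 < w i)%N.
  by move: xi; rewrite mxE pmulr_lgt0 ?invr_gt0 // ltr0n.
have [v cv vw] := wP i wi.
apply: (cP v x _); last by rewrite cv.
split; first by rewrite divr_gt0.
move=> k l; have [sw ws] := vw l.
rewrite ord1 !mxE /ball /= -mulrBl normrM
  (ger0_norm (x := _^-1)) ?invr_ge0 ?ler0n //.
rewrite ltr_pM2r ?invr_gt0 // ltr_norml; apply/andP; split.
  by rewrite ltrBrDl ltrBlDr -natrD ltr_nat.
by rewrite ltrBlDl -natrD ltr_nat.
Qed.

(** * Convex combinations and compactness in the ambient space *)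

Lemma convex_set_sum (R : realType) (E : lmodType R) (D : set E) (n : nat)
    (w : 'I_n -> R) (p : 'I_n -> E) :
  @convex_set R E D -> (forall i, 0 <= w i) -> \sum_i w i = 1 ->
  (forall i, D (p i)) -> D (\sum_i w i *: p i).
Proof.
move=> cD; elim: n w p => [|n IH] w p w0 w1 Dp.
  by move: w1; rewrite big_ord0 => /eqP; rewrite eq_sym oner_eq0.
have w1' : \sum_i w (widen_ord (leqnSn n) i) = 1 - w ord_max.
  by rewrite -w1 big_ord_recr /= addrK.
have wl0 : 0 <= 1 - w ord_max by rewrite -w1'; exact: sumr_ge0.
(* If the last weight is 1 the others cannot be renormalised, but then they all vanish. *)
have [wl1|wl1] := eqVneq (1 - w ord_max) 0.
  rewrite big_ord_recr /= big1 ?add0r => [|i _].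
    by move/eqP: wl1; rewrite subr_eq0 => /eqP <-; rewrite scale1r.
  by rewrite (psumr_eq0P _ (etrans w1' wl1)) ?scale0r.
have Dq : D (\sum_i (w (widen_ord (leqnSn n) i) / (1 - w ord_max)) *:
              p (widen_ord (leqnSn n) i)).
  apply: IH => // [i|]; first by rewrite divr_ge0.
  by rewrite -mulr_suml w1' divff.
have wle1 : w ord_max <= 1 by rewrite -subr_ge0.
have := cD _ _ (Itv01 (w0 _) wle1) (mem_set (Dp ord_max)) (mem_set Dq).
rewrite inE /conv /=; congr D.
rewrite big_ord_recr addrC scaler_sumr; congr (_ + _).
by apply: eq_bigr => i _; rewrite scalerA mulrC divfK.
Qed.

(** The traces on [M] of finite intersections generate a proper filter, and its cluster point in [M]
    lies in every closed [B y]. *)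
Lemma compact_finite_intersection (T : topologicalType) (M : set T)
    (K : choiceType) (B : K -> set T) :
  compact M -> (forall y, closed (B y)) ->
  (forall s : seq K, exists2 x, M x & {in s, forall y, B y x}) ->
  exists2 x, M x & forall y, B y x.
Proof.
move=> cM clB fin.
pose F := filter_from [set: seq K]
  (fun s => [set x | M x /\ {in s, forall y, B y x}]).
have FF : ProperFilter F.
  apply: filter_from_proper => [|s _]; last by have [x] := fin s; exists x.
  apply: filter_from_filter; first by exists [::].
  move=> s t _ _; exists (s ++ t) => // x [Mx Bx].
  by split; split => // y ys; apply: Bx; rewrite mem_cat ys ?orbT.
have [|p [Mp clp]] := cM F FF; first by exists [::] => // x [].
exists p => // y; apply: clB => A Ap.
by apply: clp => //; exists [:: y] => // x [_]; apply; rewrite mem_head.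
Qed.

Lemma continuous_combination (R : realType) (X : topologicalLmodType R) n
  (z : 'I_n -> X) : continuous (fun x : 'rV[R]_n => \sum_i x 0 i *: z i).
Proof.
apply: continuous_big => [|i _ x]; first exact: add_continuous.
apply: (@continuous_comp _ (R^o * X)%type _ (fun x : 'rV[R]_n => (x 0 i, z i))
  (fun q => q.1 *: q.2)); last exact: scale_continuous.
apply: (@cvg_pair _ _ _ (nbhs x) (nbhs (x 0 i : R^o)) (nbhs (z i))).
  exact: coord_continuous.
exact: cvg_cst.
Qed.

(** Vertices of weight zero are dropped, so that the index supplied by [KKM_type] has a positive
    coordinate, as [KKM] demands. *)
Lemma conv_hull_support (R : realType) (X : lmodType R) n
    (z : 'I_n -> X) (x : 'rV[R]_n) (J := [set i | 0 < x 0 i]%SET) :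
  simplex x ->
  conv_hull (range (fun k : 'I_#|J| => z (enum_val k))) (\sum_i x 0 i *: z i).
Proof.
move=> [x0 x1].
have xJ i : i \notin J -> x 0 i = 0.
  by rewrite inE lt_def x0 andbT negbK => /eqP.
exists #|J|, (fun k => x 0 (enum_val k)), (fun k => z (enum_val k)).
split => //.
- rewrite -x1 [RHS](bigID (mem J)) /= [X in _ + X]big1 => [|i /xJ//].
  by rewrite addr0 [RHS]big_enum_val.
- rewrite [LHS](bigID (mem J)) /= [X in _ + X]big1 => [|i /xJ ->].
    by rewrite addr0 [LHS]big_enum_val.
  by rewrite scale0r.
Qed.

(** * The common solution in topological vector spaces *)

Unset Implicit Arguments.

Theorem theorem2p3 (R : realType) (X Y : topologicalLmodType R)
  (D : set X) (K : Type) (F : X -> K -> set Y) (G : X -> X -> set Y)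
  (M : set X) (L : set K) :
  D !=set0 -> @convex_set R X D -> [set: K] !=set0 ->
  (forall y : K, compactly_closed [set x | D x /\ F x y 0]) ->
  KKM_type D G ->
  (forall y : K, exists2 z, D z & forall x, D x -> G z x 0 -> F x y 0) ->
  M !=set0 -> compact M -> M `<=` D -> finite_set L ->
  (forall x, D x -> ~ M x -> exists2 y, L y & ~ F x y 0) ->
  exists2 xbar, M xbar & forall y : K, F xbar y 0.
Proof.
move=> _ cD [y0 _] clF kkmG GF _ cM MD finL FL.
(* On a fixed compact [Q], a compactly closed set is the trace of a set closed in all of [X]. *)
have clE (Q : set X) : compact Q -> forall y, exists B : set X,
    closed B /\ forall x, Q x -> (B x <-> D x /\ F x y 0).
  move=> cQ y; have /closed_subspaceP[B clB BQ] := clF y Q cQ.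
  exists B; split=> // x Qx; have /seteqP[sub1 sub2] := BQ; split=> [Bx|Ax].
    by have [[]] := sub1 x (conj Bx Qx).
  by have [] := sub2 x (conj (conj Ax Qx) Qx).
have /choice[B BP] := clE M cM.
(* [{classic K}] gives the bare type [K] the choice structure that [compact_finite_intersection]
   asks for. *)
have [x Mx Bx] : exists2 x, M x & forall y : {classic K}, B y x; last first.
  by exists x => // y; have /((BP y).2 x Mx)[] := Bx y.
apply: (compact_finite_intersection cM) => [y|s]; first exact: (BP y).1.
have /(@finite_seqP {classic K})[l lL] := finL.
pose t : seq {classic K} := l ++ s.
pose n := size t.
(* Putting [y0] in front makes the list nonempty and shifts the position of each member of [t] by
   one. *)
pose y (i : 'I_n.+1) : K := nth (y0 : {classic K}) (y0 :: t) i.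
have /choice[z zP] : forall i, exists z,
    D z /\ forall x, D x -> G z x 0 -> F x (y i) 0.
  by move=> i; have [z] := GF (y i); exists z.
pose f (x : 'rV[R]_n.+1) := \sum_i x 0 i *: z i.
have fc : continuous f := @continuous_combination R X _ z.
have Df x : simplex x -> D (f x).
  by move=> [x0 x1]; apply: convex_set_sum => // i; exact: (zP i).1.
have cQ : compact (f @` @simplex R n.+1).
  apply: continuous_compact; last exact: compact_simplex.
  exact: continuous_subspaceT.
(* A second family of closed sets is needed on the image of [f], since [f x] is not yet known to lie
   in [M]. *)
have /choice[C CP] := clE _ cQ.
have [x sx Cx] : exists2 x, @simplex R n.+1 x & forall i, (f @^-1` C (y i)) x.
  apply: (@KKM R n (fun i => f @^-1` C (y i))) => [i|x sx].
    by apply: preimage_closed => [u _|]; [exact: fc | exact: (CP _).1].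
  have [|k Gk] := kkmG _ _ _ _ (conv_hull_support z sx) (Df x sx).
    by move=> k; exact: (zP _).1.
  exists (enum_val k); first by have := enum_valP k; rewrite inE.
  apply/(CP _).2; first by exists x.
  by split; [exact: Df | apply: (zP _).2 => //; exact: Df].
have Ft u : u \in t -> F (f x) u 0.
  move=> ut; have uP : ((index u t).+1 < n.+1)%N by rewrite ltnS index_mem.
  have /((CP _).2)[|_] := Cx (Ordinal uP); first by exists x.
  by rewrite /y /= nth_index.
have Mfx : M (f x).
  apply: contrapT => /(FL _ (Df x sx))[u Lu]; apply.
  by apply: Ft; rewrite mem_cat; move: Lu; rewrite lL /= => ->.
exists (f x) => // u us; apply/(BP u).2 => //; split; first exact: Df.
by apply: Ft; rewrite mem_cat us orbT.
Qed.
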